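(* The numbers $P_{1^{-2}2^{1}3^{2}6^{-1}}(n)$, defined by $\sum_{n\ge0}P_{1^{-2}2^{1}3^{2}6^{-1}}(n)q^n=\frac{f_2f_3^2}{f_1^2f_6}$, form a $3$-convolutive sequence.
   Context: $f_i:=(q^i;q^i)_\infty=\prod_{k\ge1}(1-q^{ik})$. A sequence $(a_n)_{n\ge0}$ is $m$-convolutive if $\sum_{n\ge0}a_{mn}q^n=\big(\sum_{n\ge0}a_nq^n\big)^m$. *)

(* Defs.v *)
From mathcomp Require Import all_boot all_order all_algebra.
Set Implicit Arguments. Unset Strict Implicit. Unset Printing Implicit Defensive.
Import GRing.Theory Num.Theory.
Local Open Scope ring_scope.

Definition fps := nat -> int.

Definition fps_one : fps := fun n => if n == 0%N then 1 else 0.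

Definition fps_mul (a b : fps) : fps :=
  fun n => \sum_(i < n.+1) a i * b (n - i)%N.

Definition fps_exp (a : fps) (m : nat) : fps := iter m (fps_mul a) fps_one.

(* f_i = (q^i;q^i)_oo = prod_{k>=1} (1 - q^{ik}).  For i >= 1 the coefficient
   of q^n only involves the factors with k <= n, so it is the n-th coefficient
   of the polynomial prod_{k=1}^{n} (1 - X^{ik}). *)
Definition f (i : nat) : fps :=
  fun n => (\prod_(k < n) (1 - 'X^(i * k.+1)) : {poly int})`_n.

(* Multiplicative inverse of a power series with constant term 1:
   b 0 = 1,  b n = - sum_{j=1}^{n} a j * b (n - j).
   inv_aux a n is the list [b 0; ...; b n]. *)
Fixpoint inv_aux (a : fps) (n : nat) : seq int :=
  match n with
  | 0 => [:: 1]
  | m.+1 => let s := inv_aux a m in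
            rcons s (- \sum_(j < m.+1) a j.+1 * nth 0 s (m - j)%N)
  end.

Definition fps_inv (a : fps) : fps := fun n => last 0 (inv_aux a n).

Definition P_eta : fps :=
  fps_mul (fps_mul (f 2) (fps_exp (f 3) 2))
          (fps_inv (fps_mul (fps_exp (f 1) 2) (f 6))).

Definition convolutive (m : nat) (a : fps) : Prop :=
  forall n, a (m * n)%N = fps_exp a m n.

(* Main.v *)
Require Import Defs.
From HB Require Import structures.
From mathcomp Require Import all_boot all_order all_algebra.
From mathcomp Require Import boolp ring zify.
Set Implicit Arguments. Unset Strict Implicit. Unset Printing Implicit Defensive.
Import GRing.Theory.
Local Open Scope ring_scope.

(** Let theta(q) be the sum over all integers j of (-1)^j q^(j^2).  Gauss's
    identity f_1^2 = f_2 theta turns the generating function into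
    P = theta(q^3) / theta(q).  Squares are never 2 modulo 3, and those divisible
    by 3 are divisible by 9, so theta(q) = theta(q^9) + q b(q^3) for some b.
    Multiplying numerator and denominator by the cofactor
    theta(q^9)^2 - q theta(q^9) b(q^3) + q^2 b(q^3)^2 makes the denominator the
    norm of theta from Z[[q]] to Z[[q^3]], and the terms of P with exponent
    divisible by 3 sum to theta(q^3) theta(q^9)^2 / norm.  The norm is
    multiplicative and that of 1 - q^k is (1 - q^k)^3 or 1 - q^(3k) according as 3
    divides k or not; hence the norm of f_i is f_(3i)^4 / f_(9i) for i prime to 3
    and that of theta is theta(q^3)^4 / theta(q^9).  The section is therefore
    (theta(q^9) / theta(q^3))^3 = P(q^3)^3. *)

(** * Power series over the integers as a commutative ring *)

Definition trunc (m : nat) (a : fps) : {poly int} := \poly_(i < m.+1) a i.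

Lemma coef_trunc m a i : (i <= m)%N -> (trunc m a)`_i = a i.
Proof. by move=> im; rewrite coef_poly ltnS im. Qed.

(** Transfers the ring laws from [{poly int}]: a coefficient of a product depends only on
    truncations of the factors. *)
Lemma fps_mul_trunc m (a b : fps) n : (n <= m)%N ->
  fps_mul a b n = (trunc m a * trunc m b)`_n.
Proof.
move=> nm; rewrite coefM; apply: eq_bigr => i _.
by rewrite !coef_trunc //; have := ltn_ord i; lia.
Qed.

Lemma fps_mulA : associative fps_mul.
Proof.
move=> a b c; apply/funext => n.
transitivity ((trunc n a * (trunc n b * trunc n c))`_n).
  rewrite coefM; apply: eq_bigr => i _.
  by rewrite (@fps_mul_trunc n) ?leq_subr // coef_trunc // leq_ord.
rewrite mulrA coefM; apply: eq_bigr => i _.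
by rewrite (@fps_mul_trunc n) ?leq_ord // coef_trunc // leq_subr.
Qed.

Lemma fps_mulC : commutative fps_mul.
Proof. by move=> a b; apply/funext => n; rewrite !(@fps_mul_trunc n) // mulrC. Qed.

Definition fps_add (a b : fps) : fps := fun n => a n + b n.
Definition fps_opp (a : fps) : fps := fun n => - a n.

Lemma fps_addA : associative fps_add.
Proof. by move=> a b c; apply/funext => n; apply: addrA. Qed.

Lemma fps_addC : commutative fps_add.
Proof. by move=> a b; apply/funext => n; apply: addrC. Qed.

Lemma fps_add0 : left_id (fun=> 0) fps_add.
Proof. by move=> a; apply/funext => n; apply: add0r. Qed.

Lemma fps_addN : left_inverse (fun=> 0) fps_opp fps_add.
Proof. by move=> a; apply/funext => n; apply: addNr. Qed.

Lemma fps_mul1 : left_id fps_one fps_mul.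
Proof.
move=> a; apply/funext => n; rewrite /fps_mul big_ord_recl /= subn0 mul1r.
by rewrite big1 ?addr0 // => i _; rewrite mul0r.
Qed.

Lemma fps_mulDl : left_distributive fps_mul fps_add.
Proof.
move=> a b c; apply/funext => n; rewrite /fps_add /fps_mul -big_split.
by apply: eq_bigr => i _; rewrite /= mulrDl.
Qed.

HB.instance Definition _ := gen_eqMixin fps.
HB.instance Definition _ := gen_choiceMixin fps.

Lemma fps_one_neq0 : fps_one != ((fun=> 0) : fps).
Proof. by apply/eqP => /(congr1 (fun a : fps => a 0%N)). Qed.

HB.instance Definition _ :=
  GRing.isZmodule.Build fps fps_addA fps_addC fps_add0 fps_addN.
HB.instance Definition _ := GRing.Zmodule_isComNzRing.Build fps
  fps_mulA fps_mulC fps_mul1 fps_mulDl fps_one_neq0.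

Lemma fpsD (a b : fps) n : (a + b) n = a n + b n. Proof. by []. Qed.
Lemma fpsN (a : fps) n : (- a) n = - a n. Proof. by []. Qed.
Lemma fpsM (a b : fps) n : (a * b) n = \sum_(i < n.+1) a i * b (n - i)%N.
Proof. by []. Qed.

Lemma fps_expE (a : fps) m : fps_exp a m = a ^+ m.
Proof. by elim: m => // m IH; rewrite exprS -IH. Qed.

Definition to_fps (p : {poly int}) : fps := fun n => p`_n.

Lemma to_fps_is_additive : zmod_morphism to_fps.
Proof. by move=> p r; apply/funext => n; rewrite /to_fps coefB. Qed.
Lemma to_fps_is_monoid_morphism : monoid_morphism to_fps.
Proof.
split=> [|p r]; apply/funext => n; last by rewrite /to_fps coefM.
by rewrite /to_fps coef1; case: n.
Qed.
HB.instance Definition _ :=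
  GRing.isZmodMorphism.Build {poly int} fps to_fps to_fps_is_additive.
HB.instance Definition _ :=
  GRing.isMonoidMorphism.Build {poly int} fps to_fps to_fps_is_monoid_morphism.

(** * Congruences modulo powers of q, and inverses *)

Definition q : fps := to_fps 'X.

(** Congruence modulo q^(N+1). Identities between infinite products or sums are checked on finite
    ones for every [N], then concluded by [eqm_eq]. *)
Definition eqm (N : nat) (a b : fps) := forall n, (n <= N)%N -> a n = b n.

Lemma eqm_trans N : forall b a c, eqm N a b -> eqm N b c -> eqm N a c.
Proof. by move=> b a c ab bc n nN; rewrite ab // bc. Qed.

Lemma eqm_sym N a b : eqm N a b -> eqm N b a.
Proof. by move=> ab n nN; rewrite ab. Qed.

Lemma eqm_le M N a b : (N <= M)%N -> eqm M a b -> eqm N a b.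
Proof. by move=> NM ab n nN; apply: ab; apply: leq_trans NM. Qed.

Lemma eqmD N (a b c d : fps) : eqm N a b -> eqm N c d -> eqm N (a + c) (b + d).
Proof. by move=> ab cd n nN; rewrite !fpsD ab // cd. Qed.

Lemma eqmB N (a b c d : fps) : eqm N a b -> eqm N c d -> eqm N (a - c) (b - d).
Proof. by move=> ab cd n nN; rewrite !(fpsD, fpsN) ab // cd. Qed.

Lemma eqmM N (a b c d : fps) : eqm N a b -> eqm N c d -> eqm N (a * c) (b * d).
Proof.
move=> ab cd n nN; rewrite !fpsM; apply: eq_bigr => i _.
by rewrite ab ?cd //; have := ltn_ord i; lia.
Qed.

Lemma eqmX N (a b : fps) m : eqm N a b -> eqm N (a ^+ m) (b ^+ m).
Proof. by move=> ab; elim: m => // m IH; rewrite !exprS; apply: eqmM. Qed.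

Lemma eqm_eq (a b : fps) : (forall N, eqm N a b) -> a = b.
Proof. by move=> ab; apply/funext => n; apply: (ab n). Qed.

Lemma eqm_trunc N a : eqm N (to_fps (trunc N a)) a.
Proof. by move=> n nN; rewrite /to_fps coef_trunc. Qed.

Lemma eqm_qM N (a : fps) : eqm N (q ^+ N.+1 * a) 0.
Proof.
move=> n nN.
have -> : (q ^+ N.+1 * a) n = (to_fps ('X^(N.+1) * trunc n a)) n.
  rewrite [in RHS]rmorphM rmorphXn /=.
  by apply: (@eqmM n) => //; apply: eqm_sym; apply: eqm_trunc.
by rewrite /to_fps mulrC coefMXn ltnS nN.
Qed.

Lemma coef_qM (a : fps) n : (q * a) n = if n is m.+1 then a m else 0.
Proof.
have -> : (q * a) n = (to_fps ('X * trunc n a)) n.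
  rewrite [in RHS]rmorphM /=.
  by apply: (@eqmM n) => //; apply: eqm_sym; apply: eqm_trunc.
rewrite /to_fps mulrC coefMX; case: n => //= n.
by rewrite coef_trunc.
Qed.

Lemma inv_auxP (a : fps) n : size (inv_aux a n) = n.+1 /\
  forall k, (k <= n)%N -> nth 0 (inv_aux a n) k = fps_inv a k.
Proof.
elim: n => [|n [IHs IHn]]; first by split=> // -[|[]].
split=> [|k]; first by rewrite /= size_rcons IHs.
rewrite leq_eqVlt => /orP[/eqP -> | kn].
  by rewrite /fps_inv -nth_last; congr nth; rewrite /= size_rcons IHs.
by rewrite /= nth_rcons IHs kn IHn.
Qed.

Lemma fps_mulV (a : fps) : a 0%N = 1 -> a * fps_inv a = 1.
Proof.
move=> a0; apply/funext => -[|n]; rewrite fpsM.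
  by rewrite big_ord1 a0 mul1r.
rewrite big_ord_recl a0 mul1r subn0 {1}/fps_inv /= last_rcons.
apply/eqP; rewrite addrC subr_eq add0r; apply/eqP; apply: eq_bigr => i _.
by rewrite (inv_auxP a n).2 ?leq_subr.
Qed.

(** Stands in for division: quotient identities below are stated with denominators cleared and
    cancelled by this lemma. *)
Lemma fps_mulI (a b c : fps) : a 0%N = 1 -> a * b = a * c -> b = c.
Proof.
move=> a0 /(congr1 (fun x => fps_inv a * x)).
by rewrite !mulrA (mulrC _ a) fps_mulV // !mul1r.
Qed.

Lemma fpsM0 (a b : fps) : (a * b) 0%N = a 0%N * b 0%N.
Proof. by rewrite fpsM big_ord1. Qed.

Lemma fpsX0 (a : fps) m : a 0%N = 1 -> (a ^+ m) 0%N = 1.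
Proof. by move=> a0; elim: m => // m IH; rewrite exprS fpsM0 a0 IH. Qed.

(** * The substitution of q^k for q *)

Definition dilate (k : nat) (a : fps) : fps :=
  fun n => if (k %| n)%N then a (n %/ k)%N else 0.

Lemma dilate_to_fps k p : (0 < k)%N -> dilate k (to_fps p) = to_fps (p \Po 'X^k).
Proof. by move=> k0; apply/funext => n; rewrite /to_fps coef_comp_poly_Xn. Qed.

Lemma eqm_dilate k N a b : eqm N a b -> eqm N (dilate k a) (dilate k b).
Proof.
move=> ab n nN; rewrite /dilate; case: ifP => // _.
by apply: ab; apply: leq_trans (leq_div _ _) nN.
Qed.

Lemma dilateD k (a b : fps) : dilate k (a + b) = dilate k a + dilate k b.
Proof.
by apply/funext => n; rewrite fpsD /dilate; case: ifP; rewrite ?addr0.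
Qed.

Lemma dilate0 k : dilate k 0 = 0.
Proof. by apply/funext => n; rewrite /dilate; case: ifP. Qed.

Lemma dilateN k (a : fps) : dilate k (- a) = - dilate k a.
Proof. by apply/funext => n; rewrite fpsN /dilate; case: ifP; rewrite ?oppr0. Qed.

(** On polynomials [dilate k] is composition with ['X^k], hence multiplicative; truncation carries
    this over to series. *)
Lemma dilateM k (a b : fps) : (0 < k)%N ->
  dilate k (a * b) = dilate k a * dilate k b.
Proof.
move=> k0; apply: eqm_eq => N.
have tE x : eqm N x (to_fps (trunc N x)) by apply/eqm_sym/eqm_trunc.
have /eqm_dilate-/(_ k) abE := eqmM (tE a) (tE b).
apply: eqm_trans abE _; rewrite -rmorphM.
rewrite dilate_to_fps // comp_polyM rmorphM /= -!dilate_to_fps //.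
by apply: eqmM; apply: eqm_dilate; apply: eqm_trunc.
Qed.

Lemma dilate1 k : (0 < k)%N -> dilate k 1 = 1.
Proof.
by move=> k0; rewrite -(rmorph1 to_fps) dilate_to_fps // comp_polyC.
Qed.

Lemma dilateX k (a : fps) m : (0 < k)%N -> dilate k (a ^+ m) = dilate k a ^+ m.
Proof.
by move=> k0; elim: m => [|m IH]; rewrite ?dilate1 // !exprS dilateM // IH.
Qed.

Lemma dilate_q k : (0 < k)%N -> dilate k q = q ^+ k.
Proof. by move=> k0; rewrite dilate_to_fps // comp_polyX rmorphXn. Qed.

(** * Trisection and the cubic norm *)

Definition sec (r : nat) (a : fps) : fps := fun n => a (3 * n + r)%N.

Lemma eqm_sec r N a b : eqm (3 * N + r)%N a b -> eqm N (sec r a) (sec r b).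
Proof. by move=> ab n nN; apply: ab; lia. Qed.

Definition join3 (a b c : fps) : fps :=
  dilate 3 a + q * dilate 3 b + q ^+ 2 * dilate 3 c.

Lemma coef_join3 a b c n : join3 a b c n =
  nth 0 [:: a (n %/ 3)%N; b (n %/ 3)%N; c (n %/ 3)%N] (n %% 3)%N.
Proof.
rewrite /join3 expr2 -mulrA !fpsD !coef_qM /dilate.
case: n => [|[|n]]; rewrite ?coef_qM ?addr0 ?add0r //.
have : (n.+2 %% 3 < 3)%N by rewrite ltn_mod.
have : (n.+2 = n.+2 %/ 3 * 3 + n.+2 %% 3)%N by exact: divn_eq.
move: (n.+2 %% 3)%N (n.+2 %/ 3)%N => r m nE.
case: r nE => [|[|[|]]] // nE _.
- by rewrite ifT ?[X in _ + X + _]ifF ?[X in _ + _ + X]ifF ?addr0 //; lia.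
- rewrite (_ : n.+1 %/ 3 = m)%N; last lia.
  by rewrite [X in X + _ + _]ifF ?[X in _ + X + _]ifT ?[X in _ + _ + X]ifF
    ?addr0 ?add0r //; lia.
- rewrite (_ : n %/ 3 = m)%N; last lia.
  by rewrite [X in X + _ + _]ifF ?[X in _ + X + _]ifF ?[X in _ + _ + X]ifT
    ?addr0 ?add0r //; lia.
Qed.

Lemma sec_join3 a b c r : (r < 3)%N -> sec r (join3 a b c) = nth 0 [:: a; b; c] r.
Proof.
move=> r3; apply/funext => n; rewrite /sec coef_join3.
rewrite (_ : (3 * n + r) %/ 3 = n)%N; last lia.
rewrite (_ : (3 * n + r) %% 3 = r)%N; last lia.
by case: r r3 => [|[|[|]]].
Qed.

Lemma join3_sec a : join3 (sec 0 a) (sec 1 a) (sec 2 a) = a.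
Proof.
apply/funext => n; rewrite coef_join3 /sec [in RHS](divn_eq n 3).
have : (n %% 3 < 3)%N by rewrite ltn_mod.
rewrite [(_ * 3)%N]mulnC.
by case: (n %% 3)%N => [|[|[|]]].
Qed.

(** Components whose positions add up to 3 or more wrap around, and the resulting q^3 becomes a
    factor q inside [dilate 3]. *)
Lemma join3M a b c a' b' c' : join3 a b c * join3 a' b' c' =
  join3 (a * a' + q * (b * c' + c * b')) (a * b' + b * a' + q * (c * c'))
        (a * c' + b * b' + c * a').
Proof.
rewrite /join3 !(dilateD, dilateM) // dilate_q //; ring.
Qed.

(* The determinant of multiplication by a on Z[[q]] as a free module with basis
   1, q, q^2 over Z[[q^3]], with q^3 renamed to q in the result. *)
Definition norm3 (a : fps) : fps :=
  sec 0 a ^+ 3 + q * sec 1 a ^+ 3 + q ^+ 2 * sec 2 a ^+ 3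
  - 3 * q * sec 0 a * sec 1 a * sec 2 a.

Lemma norm3_join3 a b c : norm3 (join3 a b c) =
  a ^+ 3 + q * b ^+ 3 + q ^+ 2 * c ^+ 3 - 3 * q * a * b * c.
Proof. by rewrite /norm3 !sec_join3. Qed.

Lemma norm3M a b : norm3 (a * b) = norm3 a * norm3 b.
Proof.
rewrite -(join3_sec a) -(join3_sec b) join3M !norm3_join3; ring.
Qed.

Lemma norm3_1 : norm3 1 = 1.
Proof.
transitivity (norm3 (join3 1 0 0)); last by rewrite norm3_join3; ring.
by congr norm3; rewrite /join3 !dilate0 dilate1 //; ring.
Qed.

(** The three sections up to index N involve the exponents up to 3N+2. *)
Lemma eqm_norm3 N a b : eqm (3 * N + 2)%N a b -> eqm N (norm3 a) (norm3 b).
Proof.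
move=> ab.
have E r : (r < 3)%N -> eqm N (sec r a) (sec r b).
  by move=> r3; apply: eqm_sec; apply: eqm_le ab; lia.
have [E0 E1 E2] : [/\ eqm N (sec 0 a) (sec 0 b), eqm N (sec 1 a) (sec 1 b)
    & eqm N (sec 2 a) (sec 2 b)] by split; apply: E.
apply: eqmB; last by apply: eqmM E2; apply: eqmM E1; apply: eqmM E0.
apply: eqmD; last by apply: eqmM => //; apply: eqmX.
apply: eqmD; last by apply: eqmM => //; apply: eqmX.
exact: eqmX.
Qed.

(** For k = 3m + r the series 1 - q^k has at most two nonzero components: 1 in position 0 and -q^m
    in position r, merged when r = 0. *)
Lemma norm3_1subq k : norm3 (1 - q ^+ k) =
  if (3 %| k)%N then (1 - q ^+ (k %/ 3)) ^+ 3 else 1 - q ^+ k.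
Proof.
have : (k %% 3 < 3)%N by rewrite ltn_mod.
have := divn_eq k 3; rewrite /dvdn; move: (k %% 3)%N (k %/ 3)%N => r m ->.
case: r => [|[|[|r]]] // _.
- transitivity (norm3 (join3 (1 - q ^+ m) 0 0)); last by rewrite norm3_join3; ring.
  congr norm3; rewrite /join3 dilateD !(dilateN, dilate1, dilate0) //.
  rewrite dilateX // dilate_q // addn0.
  by rewrite mulnC exprM; ring.
- transitivity (norm3 (join3 1 (- q ^+ m) 0)).
    congr norm3; rewrite /join3 !(dilateN, dilate1, dilate0) //.
    rewrite dilateX // dilate_q // exprD mulnC exprM.
    by ring.
  by rewrite norm3_join3 exprD exprM /=; ring.
- transitivity (norm3 (join3 1 0 (- q ^+ m))).
    congr norm3; rewrite /join3 !(dilateN, dilate1, dilate0) //.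
    rewrite dilateX // dilate_q // exprD mulnC exprM.
    by ring.
  by rewrite norm3_join3 exprD exprM /=; ring.
Qed.

(** * Finite products approximating f_i, and their norms *)

Definition fpart (i m : nat) : fps := \prod_(k < m) (1 - q ^+ (i * k.+1)).

Lemma to_fps_fpart i m :
  to_fps (\prod_(k < m) (1 - 'X^(i * k.+1))) = fpart i m.
Proof.
rewrite rmorph_prod; apply: eq_bigr => k _.
by rewrite rmorphB rmorph1 rmorphXn.
Qed.

Lemma fpartS i m : fpart i m.+1 = fpart i m * (1 - q ^+ (i * m.+1)).
Proof. by rewrite /fpart big_ord_recr. Qed.

Lemma eqm_fpartS i m : (0 < i)%N -> eqm m (fpart i m.+1) (fpart i m).
Proof.
move=> i0; rewrite fpartS mulrBr mulr1.
rewrite -[X in eqm _ _ X]subr0; apply: eqmB => //.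
have -> : (i * m.+1 = m.+1 + (i * m.+1 - m.+1))%N by nia.
by rewrite exprD mulrCA; apply: eqm_qM.
Qed.

(** The coefficient of q^n no longer changes from [s n] onwards. This serves [f] and [theta], both
    defined as diagonals. *)
Lemma eqm_diag (s : nat -> fps) m :
  (forall k, eqm k (s k.+1) (s k)) -> eqm m (fun n => s n n) (s m).
Proof.
move=> sP n nm; rewrite -(subnKC nm).
elim: (m - n)%N => [|d IH]; first by rewrite addn0.
by rewrite IH addnS; symmetry; apply: sP; lia.
Qed.

Lemma eqm_f i m : (0 < i)%N -> eqm m (f i) (fpart i m).
Proof.
move=> i0 n nm; transitivity (fpart i n n); first by rewrite -to_fps_fpart.
by apply: (@eqm_diag (fpart i) m) nm => k; apply: eqm_fpartS.
Qed.

Lemma f_0 i : f i 0%N = 1.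
Proof. by rewrite /f big_ord0 coef1. Qed.

Lemma f_dilate k i : (0 < k)%N -> (0 < i)%N -> f (k * i) = dilate k (f i).
Proof.
move=> k0 i0; apply: eqm_eq => N; have ki0 : (0 < k * i)%N by rewrite muln_gt0 k0.
apply: eqm_trans (@eqm_f _ N ki0) _.
apply: eqm_sym; apply: eqm_trans (@eqm_dilate k _ _ _ (@eqm_f _ N i0)) _.
rewrite /fpart (big_morph (dilate k) (id1 := 1) (op1 := *%R)); first last.
- exact: dilate1.
- by move=> a b; rewrite dilateM.
rewrite (eq_bigr (fun j : 'I_N => 1 - q ^+ (k * i * j.+1))) // => j _.
by rewrite dilateD dilateN dilate1 // dilateX // dilate_q // -exprM mulnA.
Qed.

(** Factors with 3 not dividing k keep the form 1 - q^(ik), while k = 3j gives (1 - q^(ij))^3.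
    Multiplying by [fpart (3 * i) n] restores the missing factors of [fpart i (3 * n)]. Each
    induction step adds three factors. *)
Lemma norm3_fpart i n : coprime 3 i ->
  norm3 (fpart i (3 * n)) * fpart (3 * i) n = fpart i (3 * n) * fpart i n ^+ 3.
Proof.
move=> ci; elim: n => [|n IH].
  by rewrite muln0 /fpart !big_ord0 expr1n !mulr1 norm3_1.
rewrite (_ : 3 * n.+1 = (3 * n).+3)%N; last lia.
have c k : (3 %| i * k)%N = (3 %| k)%N by rewrite Gauss_dvdr.
rewrite !fpartS !norm3M !norm3_1subq !c.
rewrite ifF; last lia.
rewrite ifF; last lia.
rewrite ifT; last lia.
have iE : (i * (3 * n).+3 = 3 * (i * n.+1))%N by lia.
rewrite (_ : (i * (3 * n).+3) %/ 3 = i * n.+1)%N; last by rewrite iE mulKn.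
rewrite (_ : 3 * i * n.+1 = i * (3 * n).+3)%N; last by lia.
rewrite exprMn; move: IH.
set A := norm3 _; set B := fpart _ _; set C := fpart _ _; set D := fpart _ _.
move=> IH.
transitivity (A * B * (1 - q ^+ (i * (3 * n).+1)) * (1 - q ^+ (i * (3 * n).+2)) *
  (1 - q ^+ (i * (3 * n).+3)) * (1 - q ^+ (i * n.+1)) ^+ 3); first by ring.
by rewrite IH; ring.
Qed.

Lemma norm3_f i : coprime 3 i -> (0 < i)%N -> norm3 (f i) * f (3 * i) = f i ^+ 4.
Proof.
move=> ci i0; apply: eqm_eq => N.
have i30 : (0 < 3 * i)%N by lia.
(* Precision N after the norm needs 3N+2 before it; 3(N+1) is the next number of factors covered by
   [norm3_fpart]. *)
have h1 := eqm_norm3 (eqm_le (_ : (3 * N + 2 <= 3 * N.+1)%N)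
  (@eqm_f _ (3 * N.+1) i0)).
have h2 := eqm_le (leqnSn N) (@eqm_f _ N.+1 i30).
have h3 := eqm_le (_ : (N <= 3 * N.+1)%N) (@eqm_f _ (3 * N.+1) i0).
have h4 := eqm_le (leqnSn N) (@eqm_f _ N.+1 i0).
rewrite exprS; apply: eqm_trans (eqmM (h1 _) h2) _; first lia.
rewrite norm3_fpart //; apply: eqm_sym; apply: eqmM; first by apply: h3; lia.
exact: eqmX.
Qed.

(** * The theta series and Gauss's identity *)

(* A finite form of Gauss's identity in the style of Shanks: the terms s > 0 on the
   right are divisible by x^(n+1).  The induction step telescopes. *)
Lemma theta_partial_sum (R : comNzRingType) (x : R) n :
  (1 + \sum_(j < n) (-1) ^+ j.+1 * x ^+ (j.+1 ^ 2) *+ 2) *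
     \prod_(i < n) (1 + x ^+ i.+1) =
  \sum_(s < n.+1) (-1) ^+ s * \prod_(i < s) (1 + x ^+ i) *
     \prod_(s.+1 <= i < n.+1) (1 - x ^+ i) * x ^+ (s * n.+1).
Proof.
elim: n => [|n IH].
  by rewrite !big_ord0 big_ord1 big_ord0 big_geq // mul0n !expr0 addr0 !mulr1.
rewrite big_ord_recr [\prod_(i < n.+1) _]big_ord_recr /= [RHS]big_ord_recr /=.
rewrite (big_geq (leqnn _)) mulr1.
set P := \prod_(i < n) (1 + x ^+ i.+1) in IH *.
set S := \sum_(j < n) _ in IH *.
have AE : \prod_(i < n.+1) (1 + x ^+ i) = 2 * P.
  by rewrite big_ord_recl expr0.
rewrite AE.
set c := (-1) ^+ n.+1.
(* Term s for n+1 is (1 + x^(n+1)) times term s for n, plus [u s.+1 - u s]. Here [u 0] vanishes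
   through its factor 1 - x^0, and [u n.+1] joins the top term to give the new theta summand. *)
pose u s := (-1) ^+ s * x ^+ (s * n.+1) * \prod_(i < s) (1 + x ^+ i) *
  \prod_(s <= i < n.+1) (1 - x ^+ i).
rewrite (eq_bigr (fun s : 'I_n.+1 => (1 + x ^+ n.+1) * ((-1) ^+ s *
    \prod_(i < s) (1 + x ^+ i) * \prod_(s.+1 <= i < n.+1) (1 - x ^+ i) *
    x ^+ (s * n.+1)) + (u s.+1 - u s))); last first.
  move=> s _; have sn : (s <= n)%N by rewrite -ltnS.
  rewrite /u (big_nat_recr n.+1) //= (@big_ltn _ _ _ s n.+1) //.
  rewrite big_ord_recr /= (mulnS s n.+1) mulSn !exprD !exprS mulN1r.
  by move: ((-1) ^+ s) => e; ring.
rewrite big_split /= -mulr_sumr -IH.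
rewrite -(big_mkord xpredT (fun s => u s.+1 - u s)) telescope_sumr //.
rewrite /u (big_geq (leqnn _)) (@big_ltn _ _ _ 0) // [x ^+ 0]expr0.
rewrite subrr mul0r mulr0 subr0 AE -/c.
rewrite mulr1 (mulnS n.+1 n.+1) exprD -mulnn; ring.
Qed.

(** The terms for j and -j are merged into the factor 2. The next summand has exponent (n+1)^2 > n,
    so the diagonal of these sums is theta. *)
Definition theta_part (n : nat) : fps :=
  1 + \sum_(j < n) (-1) ^+ j.+1 * q ^+ (j.+1 ^ 2) *+ 2.

Definition theta : fps := fun n => theta_part n n.

Lemma eqm_theta n : eqm n theta (theta_part n).
Proof.
apply: eqm_diag => k; rewrite /theta_part big_ord_recr /= addrA.
rewrite -[X in eqm _ _ X]addr0; apply: eqmD => //.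
have -> : (k.+1 ^ 2 = k.+1 + k * k.+1)%N by rewrite -mulnn; lia.
by rewrite exprD mulrCA -mulrnAr; apply: eqm_qM.
Qed.

(** Since 1 - q^(2i) = (1 - q^i)(1 + q^i), [theta_partial_sum] applies after extracting [fpart 1 N].
    Its term s = 0 is the second [fpart 1 N], and the others vanish modulo q^(N+1). *)
Lemma gauss_theta : f 1 ^+ 2 = f 2 * theta.
Proof.
apply: eqm_eq => N.
have h1 := @eqm_f 1 N isT; have h2 := @eqm_f 2 N isT.
apply: eqm_trans (eqmX 2 h1) _; apply: eqm_sym.
apply: eqm_trans (eqmM h2 (@eqm_theta N)) _.
have -> : fpart 2 N = fpart 1 N * \prod_(i < N) (1 + q ^+ i.+1).
  rewrite /fpart -big_split; apply: eq_bigr => i _ /=.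
  by rewrite mul1n mulnC exprM; ring.
rewrite -mulrA expr2; apply: eqmM => //.
rewrite mulrC theta_partial_sum big_ord_recl.
rewrite -[X in eqm _ _ X]addr0; apply: eqmD.
  rewrite big_ord0 !mul1r mul0n mulr1 /fpart big_add1 big_mkord /=.
  by move=> n _; congr (_ n); apply: eq_bigr => i _; rewrite mul1n.
elim/big_ind: _ => // [a b a0 b0|s _].
  by rewrite -[0]addr0; apply: eqmD.
by rewrite lift0 mulSn exprD mulrCA; apply: eqm_qM.
Qed.

Lemma gauss_theta3 : f 3 ^+ 2 = f 6 * dilate 3 theta.
Proof.
rewrite (@f_dilate 3 1) // (@f_dilate 3 2) // -dilateX // gauss_theta.
by rewrite dilateM.
Qed.

(** * Coefficients and trisection of theta *)

Lemma coef_signM k (a : fps) n : ((-1) ^+ k * a) n = (-1) ^+ k * a n.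
Proof.
elim: k => [|k IH]; first by rewrite !mul1r.
by rewrite !exprS !mulN1r !mulNr fpsN IH.
Qed.

Lemma coef_theta_part n k : theta_part n k =
  (k == 0%N)%:R + \sum_(j < n) (-1) ^+ j.+1 * (k == j.+1 ^ 2)%N%:R *+ 2.
Proof.
have cX m : (q ^+ m) k = (k == m)%:R by rewrite /q -rmorphXn /= /to_fps coefXn.
rewrite /theta_part fpsD -(expr0 q) cX; congr (_ + _).
elim: n => [|n IH]; first by rewrite !big_ord0.
by rewrite !big_ord_recr /= fpsD IH mulr2n fpsD coef_signM cX -mulr2n.
Qed.

Lemma theta_square m : theta (m.+1 ^ 2)%N = (-1) ^+ m.+1 *+ 2.
Proof.
have mm : (m < m.+1 ^ 2)%N by rewrite -mulnn; nia.
rewrite /theta coef_theta_part (bigD1 (Ordinal mm)) //= eqxx mulr1.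
rewrite big1 ?addr0 ?add0r // => j /eqP jm.
rewrite eqn_exp2r // eqSS eq_sym (_ : (_ == m) = false) ?mulr0 ?mul0rn //.
by apply/eqP => e; apply: jm; apply: val_inj.
Qed.

Lemma theta_nonsquare n : (forall m, n <> m ^ 2)%N -> theta n = 0.
Proof.
move=> nsq; rewrite /theta coef_theta_part big1 => [|j _].
  by case: eqP => // n0; case: (nsq 0%N).
by case: eqP => [/nsq|_]; rewrite ?mulr0 ?mul0rn.
Qed.

Lemma sqr_mod3 m : (m ^ 2 %% 3 = ~~ (3 %| m))%N.
Proof.
have : (m %% 3 < 3)%N by rewrite ltn_mod.
by rewrite -modnXm /dvdn; case: (m %% 3)%N => [|[|[|]]].
Qed.

Lemma sec2_theta : sec 2 theta = 0.
Proof.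
apply/funext => n; apply: theta_nonsquare => m e; have := sqr_mod3 m.
by rewrite -e; lia.
Qed.

Lemma sec0_theta : sec 0 theta = dilate 3 theta.
Proof.
apply/funext => n; rewrite /sec addn0 /dilate.
(* A square divisible by 3 is 9 l^2, so both sides are supported on n = 3 l^2. *)
have dvd3 m : (3 * n = m ^ 2)%N -> exists l, (m = 3 * l)%N /\ (n = 3 * l ^ 2)%N.
  move=> e; have := sqr_mod3 m; rewrite -e modnMr.
  case: (boolP (3 %| m)%N) => // /dvdnP[l ml] _; exists l.
  by rewrite ml -!mulnn in e *; lia.
case: (boolP (3 %| n)%N) => [/dvdnP[l nl]|n3]; last first.
  by apply: theta_nonsquare => m /dvd3[l [_ nl]]; rewrite nl dvdn_mulr in n3.
rewrite nl mulnK //.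
have [[m lm]|nsq] := pselect (exists m, l = m ^ 2)%N; last first.
  rewrite !theta_nonsquare // => m e; apply: nsq; first by exists m.
  move: e; rewrite -nl => /dvd3[k [_ nk]]; exists k; lia.
case: m lm => [-> //|m lm].
rewrite (_ : (3 * (l * 3) = (3 * m.+1 - 1).+1 ^ 2)%N); last first.
  by rewrite lm -!mulnn; lia.
(* The signs agree because 3(m+1) and m+1 have the same parity. *)
rewrite lm !theta_square -(signr_odd _ m.+1) -signr_odd; congr (_ ^+ _ *+ 2); lia.
Qed.

Lemma theta_join3 : theta = join3 (dilate 3 theta) (sec 1 theta) 0.
Proof. by rewrite -{1}(join3_sec theta) sec0_theta sec2_theta. Qed.

Lemma theta_0 : theta 0%N = 1.
Proof. by rewrite /theta /theta_part big_ord0. Qed.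

(** * The norm of theta and the final cancellation *)

Lemma norm3_theta : norm3 theta * dilate 3 theta = theta ^+ 4.
Proof.
have N1 := @norm3_f 1 isT isT; have N2 := @norm3_f 2 isT isT.
have NG : norm3 (f 1) ^+ 2 = norm3 (f 2) * norm3 theta.
  by rewrite -norm3M -gauss_theta !expr2 norm3M.
rewrite !/(3 * _)%N /= in N1 N2.
(* By [NG] the norm of theta is (f_1^4/f_3)^2 f_6/f_2^4. The factor [f 2 ^+ 4] clears the
   denominator, and [f 6] turns [dilate 3 theta] into [f 3 ^+ 2]. *)
apply: (@fps_mulI (f 2 ^+ 4 * f 6)); first by rewrite fpsM0 fpsX0 ?f_0.
transitivity (f 2 ^+ 4 * norm3 theta * (f 6 * dilate 3 theta)); first by ring.
rewrite -gauss_theta3 -[in LHS]N2.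
transitivity (f 6 * f 3 ^+ 2 * (norm3 (f 2) * norm3 theta)); first by ring.
rewrite -NG [LHS](_ : _ = f 6 * (norm3 (f 1) * f 3) ^+ 2); last by ring.
rewrite N1 [LHS](_ : _ = f 6 * (f 1 ^+ 2) ^+ 4); last by ring.
rewrite gauss_theta; ring.
Qed.

Lemma P_eta_theta : P_eta * theta = dilate 3 theta.
Proof.
pose d := f 1 ^+ 2 * f 6.
have d0 : d 0%N = 1 by rewrite /d fpsM0 fpsX0 ?f_0.
have Pd : P_eta * d = f 2 * f 3 ^+ 2.
  rewrite /P_eta !fps_expE -/d -[LHS]mulrA [X in _ * X]mulrC fps_mulV //.
  by rewrite mulr1.
apply: (@fps_mulI (f 2 * f 6)); first by rewrite fpsM0 !f_0.
transitivity (P_eta * d); first by rewrite /d gauss_theta; ring.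
by rewrite Pd gauss_theta3; ring.
Qed.

Theorem theorem4p3 : convolutive 3 P_eta.
Proof.
move=> n; rewrite fps_expE; set b := sec 1 theta; set t3 := dilate 3 theta.
suff <- : sec 0 P_eta = P_eta ^+ 3 by rewrite /sec addn0.
have thetaE : theta = join3 t3 b 0 by exact: theta_join3.
have cofactor : theta * join3 (t3 ^+ 2) (- (t3 * b)) (b ^+ 2) =
    join3 (norm3 theta) 0 0.
  rewrite thetaE norm3_join3 join3M.
  by congr join3; ring.
have secP : sec 0 P_eta * norm3 theta = theta * t3 ^+ 2.
  (* Multiplying [P_eta] by a series in q^3 multiplies its section 0 by that series in q. On the
     other side [P_eta * theta] is itself a series in q^3, so only component 0 of the cofactor,
     [t3 ^+ 2], survives. *)
  have := congr1 (fun a => sec 0 (P_eta * a)) cofactor.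
  rewrite mulrA P_eta_theta -{1}(join3_sec P_eta) join3M sec_join3 //=.
  rewrite (_ : dilate 3 theta = join3 theta 0 0); last first.
    by rewrite /join3 !dilate0; ring.
  by rewrite join3M sec_join3 //= !(mulr0, mul0r, addr0) => ->.
(* Since theta^4 is [norm3 theta * t3], both sides become theta t3^3, with t3 equal to
   [P_eta * theta]. *)
apply: (@fps_mulI (theta ^+ 4)); first by rewrite fpsX0 // theta_0.
rewrite -{1}norm3_theta -/t3.
transitivity (sec 0 P_eta * norm3 theta * t3); first by ring.
rewrite secP [LHS](_ : _ = theta * t3 ^+ 3); last by ring.
by rewrite /t3 -P_eta_theta; ring.
Qed.
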